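(* Let $s = p_1\cdots p_m$ be a product of distinct primes and let $\mathbb{F}_i = \prod_{j \in \{1,\dots,m\}\setminus\{i\}}\mathbb{Z}_{p_j}$ for all $1 \leq i \leq m$. Then there is an injective function $$\mathcal{L}(\mathbb{Z}_{s},+)\hookrightarrow \prod_{i=1}^m\mathcal{L}(\mathbb{Z}_{p_i},\mathbb{F}_i)^{p_i+1}$$ from the lattice $\mathcal{L}(\mathbb{Z}_s,+)$ of all clones on $\mathbb{Z}_s$ containing $\mathrm{Clo}(\mathbb{Z}_s,+)$ to the direct product, over $i=1,\dots,m$, of the $(p_i+1)$-th powers of the lattices $\mathcal{L}(\mathbb{Z}_{p_i},\mathbb{F}_i)$ of all $(\mathbb{Z}_{p_i},\mathbb{F}_i)$-linearly closed clonoids.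
   Context: $\mathbb{N}=\{1,2,3,\dots\}$. A clone on a set $A$ is a set of finitary functions $A^n\to A$ ($n\in\mathbb{N}$) containing all projections and closed under composition. $\mathrm{Clo}(\mathbb{Z}_s,+)$ is the clone of all term operations of $(\mathbb{Z}_s,+)$, i.e. the clone on $\mathbb{Z}_s$ generated by the addition. Linearly closed clonoids: let $p$ be a prime and let $\mathbb{K}=\prod_{j\in J}\mathbb{Z}_{q_j}$ be a finite product of prime fields (for $J=\emptyset$, $\mathbb{K}$ is a one-element set). An element of $\mathbb{K}^n$ is written as $(\mathbf{x}_j)_{j\in J}$ with $\mathbf{x}_j\in\mathbb{Z}_{q_j}^n$. For a set $C$ of functions, $C^{[n]}$ denotes the set of its $n$-ary members. A $(\mathbb{Z}_p,\mathbb{K})$-linearly closed clonoid is a non-empty set $C$ of functions $f\colon\mathbb{K}^n\to\mathbb{Z}_p$ ($n\in\mathbb{N}$ arbitrary) such that: (1) for all $n\in\mathbb{N}$, $f,g\in C^{[n]}$ and $a,b\in\mathbb{Z}_p$, $af+bg\in C^{[n]}$; (2) for all $l,n\in\mathbb{N}$, $f\in C^{[n]}$ and matrices $A_j\in\mathbb{Z}_{q_j}^{n\times l}$ ($j\in J$), the function $\mathbb{K}^l\to\mathbb{Z}_p$, $(\mathbf{x}_j)_{j\in J}\mapsto f((A_j\cdot\mathbf{x}_j^t)_{j\in J})$ is in $C^{[l]}$. $\mathcal{L}(\mathbb{Z}_p,\mathbb{K})$ is the lattice of all such clonoids ordered by inclusion. *)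

(* Defs.v *)
From mathcomp Require Import all_boot all_algebra.
From mathcomp Require Import boolp classical_sets.

Set Implicit Arguments.
Unset Strict Implicit.
Unset Printing Implicit Defensive.

Import GRing.Theory.
Local Open Scope classical_set_scope.
Local Open Scope ring_scope.

(* Functions of all arities >= 1, where [D n] is the domain of the n-ary ones.
   Arities start at 1: the index [n] stands for arity [n.+1]. *)
Definition multiary (D : nat -> Type) (B : Type) : Type :=
  {n : nat & D n.+1 -> B}.

Definition of_arity (D : nat -> Type) (B : Type) (C : set (multiary D B))
    (n : nat) : set (D n.+1 -> B) :=
  [set f | C (existT (fun k => D k.+1 -> B) n f)].

Definition power (A : Type) (n : nat) : Type := 'I_n -> A.

Definition operation (A : Type) : Type := multiary (power A) A.

Definition is_clone (A : Type) (C : set (operation A)) : Prop :=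
  (forall (n : nat) (i : 'I_n.+1), of_arity C (fun x : power A n.+1 => x i)) /\
  (forall (n l : nat) (f : power A n.+1 -> A)
          (g : 'I_n.+1 -> power A l.+1 -> A),
     of_arity C f -> (forall i, of_arity C (g i)) ->
     of_arity C (fun x : power A l.+1 => f (fun i => g i x))).

Definition add_op (V : nmodType) : operation V :=
  existT (fun k => power V k.+1 -> V) 1%N
    (fun x : power V 2 => x ord0 + x ord_max).

(* [smallest P G] is the intersection of all sets satisfying [P] that
   contain [G]. *)
Definition Clo_add (V : nmodType) : set (operation V) :=
  smallest (@is_clone V) [set add_op V].
Arguments Clo_add V _ : clear implicits.

(* ['Z_s] has s elements only for s > 1. *)
Definition clones_over_add (s : nat) : set (set (operation 'Z_s)) :=
  [set C | is_clone C /\ Clo_add 'Z_s `<=` C].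
Arguments clones_over_add s _ : clear implicits.

(* [(\prod_j Z_(q j))^n], whose elements are families of column vectors. *)
Definition prod_power (J : finType) (q : J -> nat) (n : nat) : Type :=
  forall j : J, 'cV['F_(q j)]_n.

Definition is_lin_clonoid (p : nat) (J : finType) (q : J -> nat)
    (C : set (multiary (prod_power q) 'F_p)) : Prop :=
  [/\ C !=set0,
      forall (n : nat) (f g : prod_power q n.+1 -> 'F_p) (a b : 'F_p),
        of_arity C f -> of_arity C g ->
        of_arity C (fun x : prod_power q n.+1 => a * f x + b * g x)
    & forall (l n : nat) (f : prod_power q n.+1 -> 'F_p)
             (M : forall j : J, 'M['F_(q j)]_(n.+1, l.+1)),
        of_arity C f ->
        of_arity C (fun x : prod_power q l.+1 => f (fun j => M j *m x j))].

Definition lin_clonoids (p : nat) (J : finType) (q : J -> nat) :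
    set (set (multiary (prod_power q) 'F_p)) :=
  [set C | is_lin_clonoid C].
Arguments lin_clonoids p {J} q _.

(* Every prime except the i-th, indexed by [{j | j != i}]. *)
Definition other_primes (m : nat) (p : 'I_m -> nat) (i : 'I_m) :
    {j : 'I_m | j != i} -> nat :=
  fun j => p (val j).
Arguments other_primes {m} p i _.

(* Main.v *)
Require Import Defs.
From mathcomp Require Import all_boot all_algebra finfield.
From mathcomp Require Import boolp classical_sets.
From mathcomp Require Import ring zify.

(* By the Chinese remainder theorem a clone [C] containing the addition of [Z_s]
   amounts to the families [E_i] of functions into [F_(p i)] whose images in [Z_s]
   belong to [C].  For [d <= p i] let [D_(i,d)] be the set of the functions [g] of
   the components other than the [i]-th such that [g * y_1 * ... * y_d] is in
   [E_i], the [y_k] being [i]-th components of variables; it is a linearly closed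
   clonoid, and [rho C] is the family of all [D_(i,d)].

   The [D_(i,d)] with arbitrary [d] determine [E_i]: every [h] in [E_i] is a
   polynomial in the [y_k] with coefficients [g] as above; each of its monomials is
   a linear combination of functions obtained from [h] by scaling the [y_k]; and a
   monomial [g * y^e] with [e < p i] can be polarized into [g * y_1 * ... * y_e] by
   substituting [y + c z] for [y].  Finally [D_(i,d+p-1) = D_(i,d)] for [p = p i]
   and [d >= 2], so that [d <= p] is enough: identifying [p] variables lowers the
   degree by [p-1]; conversely, substituting [g * y_1 * ... * y_d] repeatedly for
   one of its own variables gives [g^p * y_1 * ... * y_(p(d-1)+1)], and [g^p = g]. *)

Set Implicit Arguments.
Unset Strict Implicit.
Unset Printing Implicit Defensive.

(** * Coefficient extraction for polynomial functions over a finite field *)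

Section LagrangeCoefficients.

Import GRing.Theory.
Local Open Scope ring_scope.

Variable F : finFieldType.

Lemma card_finField_gt0 : (0 < #|F|)%N.
Proof. by apply/card_gt0P; exists 0. Qed.

Lemma finField_fermat (x : F) : x != 0 -> x ^+ #|F|.-1 = 1.
Proof.
move=> x0; apply: (mulfI x0).
by rewrite -exprS prednK ?card_finField_gt0 // expf_card mulr1.
Qed.

(** By Fermat, the polynomial representing the indicator function of [c]. *)
Definition lagrange_poly (c : F) : {poly F} := 1 - ('X - c%:P) ^+ #|F|.-1.

Definition lagrange_coef (e : nat) (c : F) : F := (lagrange_poly c)`_e.

Lemma size_lagrange_poly c : (size (lagrange_poly c) <= #|F|)%N.
Proof.
apply: (leq_trans (size_polyD _ _)); rewrite geq_max size_poly1.
rewrite card_finField_gt0 size_polyN size_exp_XsubC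
  prednK ?card_finField_gt0 ?leqnn //.
Qed.

Lemma horner_lagrange_poly c y : (lagrange_poly c).[y] = (y == c)%:R.
Proof.
rewrite /lagrange_poly !hornerE.
have [->|yc] := eqVneq y c.
  rewrite subrr expr0n; have : (#|F|.-1 != 0)%N.
    by rewrite -lt0n -subn1 subn_gt0 finNzRing_gt1.
  by move/negbTE ->; rewrite subr0.
by rewrite finField_fermat ?subr_eq0 // subrr.
Qed.

Lemma sum_lagrange_coef c y :
  \sum_(e < #|F|) lagrange_coef e c * y ^+ e = (y == c)%:R.
Proof.
by rewrite -horner_lagrange_poly (horner_coef_wide _ (size_lagrange_poly c)).
Qed.

(** [q] and its Lagrange interpolant have size at most [#|F|] and agree on all of [F], so they
    coincide. *)
Lemma coef_lagrange (q : {poly F}) e : (size q <= #|F|)%N ->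
  \sum_c lagrange_coef e c * q.[c] = q`_e.
Proof.
move=> sq.
suff -> : q = \sum_c q.[c] *: lagrange_poly c.
  rewrite coef_sum; apply: eq_bigr => c _; rewrite coefZ mulrC -/(lagrange_coef e c).
  rewrite horner_sum (bigD1 c) //= hornerZ horner_lagrange_poly eqxx mulr1.
  rewrite big1 ?addr0 // => b bc.
  by rewrite hornerZ horner_lagrange_poly eq_sym (negbTE bc) mulr0.
apply/eqP; rewrite -subr_eq0; apply/eqP.
apply: (@roots_geq_poly_eq0 _ _ (enum F)); last 2 first.
- exact: enum_uniq.
- rewrite -cardE; apply: (leq_trans (size_polyD _ _)); rewrite geq_max sq size_polyN.
  apply: (leq_trans (size_sum _ _ _)); apply/bigmax_leqP => c _.
  by apply: (leq_trans (size_scale_leq _ _)); exact: size_lagrange_poly.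
apply/allP => y _; rewrite /root !hornerE horner_sum (bigD1 y) //= hornerZ.
rewrite horner_lagrange_poly eqxx mulr1 big1 ?addr0 ?subrr // => b yb.
by rewrite hornerZ horner_lagrange_poly eq_sym (negbTE yb) mulr0.
Qed.

Lemma sum_lagrange_coefX e n : (n < #|F|)%N ->
  \sum_c lagrange_coef e c * c ^+ n = (e == n)%:R.
Proof.
move=> nF; rewrite -coefXn -coef_lagrange ?size_polyXn //.
by apply: eq_bigr => c _; rewrite hornerXn.
Qed.

Lemma sum_lagrange_coef_shift (y z : F) n : (n.+1 < #|F|)%N ->
  \sum_c lagrange_coef 1 c * (y + c * z) ^+ n.+1 = n.+1%:R * y ^+ n * z.
Proof.
move=> nF; pose q := (y%:P + z *: 'X) ^+ n.+1.
have sz1 : (size (y%:P + z *: 'X)%R <= 2)%N.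
  rewrite (leq_trans (size_polyD _ _)) // geq_max (leq_trans (size_polyC_leq1 _)) //=.
  by rewrite (leq_trans (size_scale_leq _ _)) // size_polyX.
have <- : q`_1 = n.+1%:R * y ^+ n * z.
  (* The linear coefficient is the derivative at 0. *)
  rewrite -[1%N]/(0.+1) -[q`_1]mulr1n -coef_deriv -horner_coef0 deriv_exp /=.
  rewrite !derivE hornerMn !hornerE -mulr_natl.
  by rewrite -!mulrA [z * _]mulrC.
rewrite -coef_lagrange; last first.
  apply: (leq_trans (size_poly_exp_leq _ _)); apply: leq_trans nF; rewrite ltnS.
  by rewrite -[X in (_ <= X)%N]mul1n leq_mul2r; apply/orP; right; lia.
by apply: eq_bigr => c _; rewrite horner_exp !hornerE [z * c]mulrC.
Qed.

Lemma lagrange_expansion (phi : F -> F) b :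
  phi b = \sum_(e < #|F|) (\sum_c lagrange_coef e c * phi c) * b ^+ e.
Proof.
under eq_bigr => e _ do rewrite mulr_suml.
rewrite exchange_big /= (bigD1 b) //= [X in _ + X]big1 => [|c cb].
  under eq_bigr => e _ do rewrite mulrAC.
  by rewrite -mulr_suml sum_lagrange_coef eqxx mul1r addr0.
under eq_bigr => e _ do rewrite mulrAC.
by rewrite -mulr_suml sum_lagrange_coef eq_sym (negbTE cb) mul0r.
Qed.

(** Scaling by [c] multiplies the degree [n] term of [phi] by [c ^+ n]; the orthogonality relation
    [sum_lagrange_coefX] then keeps only [n = e]. *)
Lemma lagrange_extraction (phi : F -> F) (y : F) e : (e < #|F|)%N ->
  \sum_c lagrange_coef e c * phi (c * y) =
  (\sum_c lagrange_coef e c * phi c) * y ^+ e.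
Proof.
pose A n := \sum_c lagrange_coef n c * phi c.
move=> eF; transitivity (\sum_(n < #|F|)
    A n * y ^+ n * (\sum_c lagrange_coef e c * c ^+ n)).
  under eq_bigr => c _ do rewrite (lagrange_expansion phi) mulr_sumr.
  rewrite exchange_big /=; apply: eq_bigr => n _; rewrite mulr_sumr.
  by apply: eq_bigr => c _; rewrite -/(A n) exprMn; ring.
rewrite (bigD1 (Ordinal eF)) //= sum_lagrange_coefX // eqxx mulr1 big1 ?addr0 //.
move=> n ne; rewrite sum_lagrange_coefX // -[e]/(val (Ordinal eF)) (inj_eq val_inj).
by rewrite eq_sym (negbTE ne) mulr0.
Qed.

End LagrangeCoefficients.

(** * Systems of functions into the prime fields; polarization and expansion *)

Section Systems.

Import GRing.Theory.
Local Open Scope ring_scope.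

Variables (m : nat) (p : 'I_m -> nat).
Hypothesis p_prime : forall i, prime (p i).

(** Infinitely many variables, so that fresh ones are always at hand; [sys_fin] below restores
    finite arity. *)
Definition valuation := nat -> forall j, 'F_(p j).

Record system (E : forall i, set (valuation -> 'F_(p i))) : Prop := System {
  sys_var : forall i k, E i (fun v => v k i);
  sys_subst : forall i h (G : nat -> forall j, valuation -> 'F_(p j)),
    E i h -> (forall k j, E j (G k j)) ->
    E i (fun v => h (fun k j => G k j v));
  sys_lin : forall i a b h h', E i h -> E i h' ->
    E i (fun v => a * h v + b * h' v);
  sys_fin : forall i h, E i h -> exists n, forall v v' : valuation,
    (forall k, (k < n)%N -> v k = v' k) -> h v = h v' }.

Section Component.

Variables (E : forall i, set (valuation -> 'F_(p i))) (sysE : system E).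
Arguments E : clear implicits.
Variable i : 'I_m.

Let card_F : #|'F_(p i)| = p i := card_Fp (p_prime i).

Definition with_comp (v : valuation) (y : nat -> 'F_(p i)) : valuation :=
  fun k => dfwith (v k) (y k).

Lemma with_comp_in v y k : with_comp v y k i = y k.
Proof. exact: dfwith_in. Qed.

Lemma with_comp_out v y k j : i != j -> with_comp v y k j = v k j.
Proof. exact: dfwith_out. Qed.

Lemma sys_eq h h' : E i h -> (forall v, h v = h' v) -> E i h'.
Proof. by move=> Eh /funext <-. Qed.

Lemma sys0 : E i (fun=> 0).
Proof.
apply: (sys_eq (sys_lin sysE 0 0 (sys_var sysE i 0) (sys_var sysE i 0))) => v.
by rewrite !mul0r addr0.
Qed.

Lemma sys_scale a h : E i h -> E i (fun v => a * h v).
Proof.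
move=> Eh; apply: (sys_eq (sys_lin sysE a 0 Eh Eh)) => v.
by rewrite mul0r addr0.
Qed.

Lemma sys_add h h' : E i h -> E i h' -> E i (fun v => h v + h' v).
Proof.
by move=> Eh Eh'; apply: (sys_eq (sys_lin sysE 1 1 Eh Eh')) => v; rewrite !mul1r.
Qed.

Lemma sys_sum (T : Type) (r : seq T) (h : T -> valuation -> 'F_(p i)) :
  (forall c, E i (h c)) -> E i (fun v => \sum_(c <- r) h c v).
Proof.
move=> Eh; elim: r => [|c r IH].
  by apply: (sys_eq sys0) => v; rewrite big_nil.
by apply: (sys_eq (sys_add (Eh c) IH)) => v; rewrite big_cons.
Qed.

(** Every component other than the [i]-th is substituted by itself. *)
Lemma sys_with h (Y : nat -> valuation -> 'F_(p i)) :
  E i h -> (forall k, E i (Y k)) ->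
  E i (fun v => h (with_comp v (fun k => Y k v))).
Proof.
move=> Eh EY.
pose G k := dfwith (fun j (v : valuation) => v k j) (Y k).
have EG k j : E j (G k j).
  by rewrite /G; case: dfwithP => // j' ij; exact: sys_var.
apply: (sys_eq (sys_subst sysE Eh EG)) => v; congr h.
apply/funext => k; apply: functional_extensionality_dep => j.
rewrite /G /with_comp; have [<-|ij] := eqVneq i j; first by rewrite !dfwith_in.
by rewrite !dfwith_out.
Qed.

(* [depends_on K P h]: besides the other components of the first [K] variables,
   [h] only reads the [i]-th component of the variables in [P]. *)
Definition depends_on (K : nat) (P : pred nat) (h : valuation -> 'F_(p i)) :=
  forall v v' : valuation,
    (forall k j, (k < K)%N -> i != j -> v k j = v' k j) ->
    (forall k, P k -> v k i = v' k i) -> h v = h v'.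

Lemma depends_on_with K P h v y : depends_on K P h ->
  (forall k, P k -> y k = v k i) -> h (with_comp v y) = h v.
Proof.
move=> dh yv; apply: dh => [k j _ ij|k Pk]; first by rewrite with_comp_out.
by rewrite with_comp_in yv.
Qed.

Lemma depends_on_sub K (P Q : pred nat) h :
  (forall k, P k -> Q k) -> depends_on K P h -> depends_on K Q h.
Proof. by move=> PQ dh v v' vK vQ; apply: dh => // k /PQ; exact: vQ. Qed.

Lemma depends_on_mon K (w : seq nat) :
  depends_on K [in w] (fun v => \prod_(k <- w) v k i).
Proof. by move=> v v' _ vw; rewrite !big_seq; apply: eq_bigr => k /vw. Qed.

Lemma depends_on_mul K P h h' : depends_on K P h -> depends_on K P h' ->
  depends_on K P (fun v => h v * h' v).
Proof. by move=> dh dh' v v' vK vP; rewrite (dh v v') // (dh' v v'). Qed.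

Lemma mon_with (w : seq nat) v y :
  \prod_(k <- w) with_comp v y k i = \prod_(k <- w) y k.
Proof. by apply: eq_bigr => k _; rewrite with_comp_in. Qed.

(* Replace [y_a] by [y_a + c y_M] and extract the part that is linear in [y_M]. *)
Lemma sys_polarize1 K M a e h :
  depends_on K [pred k | (k < M)%N && (k != a)] h -> (a < M)%N ->
  (e.+1 < p i)%N ->
  E i (fun v => h v * v a i ^+ e.+1) ->
  E i (fun v => (h v * v M i) * v a i ^+ e).
Proof.
move=> dh aM ep Eh.
have Ec c : E i (fun v => h v * (v a i + c * v M i) ^+ e.+1).
  pose Y k v := if k == a then v a i + c * v M i else v k i : 'F_(p i).
  have EY k : E i (Y k).
    rewrite /Y; case: eqP => _; last exact: sys_var.
    by apply: sys_add; [|apply: sys_scale]; exact: sys_var.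
  apply: (sys_eq (sys_with Eh EY)) => v.
  rewrite with_comp_in /Y eqxx (depends_on_with dh) // => k /andP[_ /negbTE].
  by move=> ->.
(* The factor [e.+1] of the linear coefficient is invertible because [e.+1 < p i]. *)
have e0 : e.+1%:R != 0 :> 'F_(p i).
  by rewrite -(dvdn_pcharf (pchar_Fp (p_prime i))) gtnNdvd.
pose r := index_enum 'F_(p i).
have := sys_scale (e.+1%:R)^-1
  (sys_sum r (fun c => sys_scale (lagrange_coef 1 c) (Ec c))).
move/sys_eq; apply=> v; under eq_bigr => c _ do rewrite mulrCA.
rewrite -mulr_sumr sum_lagrange_coef_shift ?card_F //.
by rewrite mulrCA -!mulrA mulKf // [v M i * _]mulrC.
Qed.

(** Each round lowers the power of [y_a] by one and creates a fresh variable [y_M], which is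
    absorbed into [h]; the bound [M] then grows by one. *)
Lemma sys_polarize K M a e h :
  depends_on K [pred k | (k < M)%N && (k != a)] h -> (a < M)%N ->
  (e.+1 < p i)%N ->
  E i (fun v => h v * v a i ^+ e.+1) ->
  E i (fun v => h v * v a i * \prod_(k <- iota M e) v k i).
Proof.
elim: e h M => [|e IH] h M dh aM ep Eh.
  by apply: (sys_eq Eh) => v; rewrite big_nil mulr1 expr1.
apply: (sys_eq (IH _ M.+1 _ _ _ (sys_polarize1 dh aM ep Eh))) => [||| v].
- apply: depends_on_mul.
    by apply: depends_on_sub dh => k /andP[kM ka]; rewrite inE ka ltnW.
  by move=> v v' _ -> //=; rewrite ltnSn eq_sym neq_ltn aM.
- exact: ltnW.
- exact: ltnW.
- by rewrite big_cons; ring.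
Qed.

(** The coefficient of [y_N ^+ e] in [u], viewed as a polynomial in [y_N] alone. *)
Definition expansion_coef (N e : nat) (u : valuation -> 'F_(p i)) v :=
  \sum_(c : 'F_(p i)) lagrange_coef e c *
    u (with_comp v (fun k => if k == N then c else v k i)).

Lemma depends_on_expansion_coef K N e u :
  depends_on K (ltn^~ N.+1) u -> depends_on K (ltn^~ N) (expansion_coef N e u).
Proof.
move=> du v v' vK vN; apply: eq_bigr => c _; congr (_ * _).
apply: du => [k j kK ij|k]; first by rewrite !with_comp_out // vK.
by rewrite /= ltnS leq_eqVlt !with_comp_in; case: eqP => //= _ /vN.
Qed.

Lemma expansion K N u v : depends_on K (ltn^~ N.+1) u ->
  u v = \sum_(e < p i) expansion_coef N e u v * v N i ^+ e.
Proof.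
move=> du; pose phi c := u (with_comp v (fun k => if k == N then c else v k i)).
have -> : u v = phi (v N i).
  by rewrite /phi (depends_on_with du) // => k _; case: eqP => [->|].
by rewrite lagrange_expansion card_F.
Qed.

(** Replacing [y_N] by [c * y_N] and combining over [c] isolates one power of [y_N]; the monomial
    over [w] avoids [N] and is untouched. *)
Lemma sys_expansion K N u (w : seq nat) e :
  depends_on K (ltn^~ N.+1) u -> (forall k, k \in w -> (N < k)%N) ->
  (e < p i)%N ->
  E i (fun v => u v * \prod_(k <- w) v k i) ->
  E i (fun v => expansion_coef N e u v * v N i ^+ e * \prod_(k <- w) v k i).
Proof.
move=> du wN ep Eu.
have Ec c : E i (fun v =>
    u (with_comp v (fun k => if k == N then c * v N i else v k i)) *
    \prod_(k <- w) v k i).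
  pose Y k v := if k == N then c * v N i else v k i : 'F_(p i).
  have EY k : E i (Y k).
    by rewrite /Y; case: eqP => _; [apply: sys_scale|]; exact: sys_var.
  apply: (sys_eq (sys_with Eu EY)) => v; congr (_ * _).
  rewrite mon_with !big_seq; apply: eq_bigr => k /wN kN; rewrite /Y.
  by rewrite eq_sym (ltn_eqF kN).
pose r := index_enum 'F_(p i).
apply: (sys_eq (sys_sum r (fun c => sys_scale (lagrange_coef e c) (Ec c)))) => v.
under [LHS]eq_bigr => c _ do rewrite mulrA.
rewrite -mulr_suml; congr (_ * _).
pose phi c := u (with_comp v (fun k => if k == N then c else v k i)).
by rewrite (lagrange_extraction phi) ?card_F.
Qed.

(** * Multilinear monomials with coefficient free of [i]-th components; periodicity in the degree *)

Section Pure.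

Variables (K : nat) (g : valuation -> 'F_(p i)).
Hypothesis pure_g : depends_on K pred0 g.

Let g_with v y : g (with_comp v y) = g v.
Proof. exact: (depends_on_with pure_g). Qed.

Lemma sys_rename (w : seq nat) (s : nat -> nat) :
  E i (fun v => g v * \prod_(k <- w) v k i) ->
  E i (fun v => g v * \prod_(k <- map s w) v k i).
Proof.
move=> Eg; have EY k : E i (fun v => v (s k) i) by exact: sys_var.
by apply: (sys_eq (sys_with Eg EY)) => v; rewrite g_with mon_with big_map.
Qed.

(** Since [w'] may have repetitions, this covers identification of variables as well as renaming. *)
Lemma sys_relabel (w w' : seq nat) : uniq w -> size w = size w' ->
  E i (fun v => g v * \prod_(k <- w) v k i) ->
  E i (fun v => g v * \prod_(k <- w') v k i).
Proof.
move=> uw sw /(sys_rename (fun k => nth 0%N w' (index k w))).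
rewrite (_ : map _ _ = w') //; apply: (@eq_from_nth _ 0%N) => [|k].
  by rewrite size_map.
rewrite size_map => kw; rewrite (nth_map 0%N) // index_uniq //.
Qed.

Definition sys_deg d := E i (fun v => g v * \prod_(k <- iota 0 d) v k i).

Lemma sys_deg_mon (w : seq nat) : uniq w ->
  sys_deg (size w) <-> E i (fun v => g v * \prod_(k <- w) v k i).
Proof.
by move=> uw; split; apply: sys_relabel; rewrite ?iota_uniq ?size_iota.
Qed.

Lemma Fp_exp_p (x : 'F_(p i)) : x ^+ p i = x.
Proof. by rewrite -[RHS]expf_card card_F. Qed.

Lemma sys_deg_lower d : sys_deg (d.+1 + (p i).-1) -> sys_deg d.+1.
Proof.
move=> Ed; have pi0 := prime_gt0 (p_prime i).
have := sys_relabel (iota_uniq 0 _) _ Ed.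
(* Variable 0 now occurs [p i] times, and [y_0 ^+ p i = y_0]. *)
move/(_ (nseq (p i).-1 0%N ++ iota 0 d.+1)).
rewrite size_iota size_cat size_nseq size_iota addnC => /(_ erefl).
move/sys_eq; apply=> v; congr (_ * _).
rewrite big_cat big_nseq iter_mulr_1 /= big_cons mulrA -exprSr prednK //.
by rewrite Fp_exp_p.
Qed.

Lemma sys_deg_lower_iter t d : sys_deg (d.+1 + t * (p i).-1) -> sys_deg d.+1.
Proof.
elim: t => [|t IH]; first by rewrite addn0.
by rewrite mulSn addnCA addnC addSn => /sys_deg_lower; rewrite -addSn; exact: IH.
Qed.

(** Each substitution of the function built so far for [y_0] in [g * y_0 * ... * y_d] contributes
    one factor [g] and [d] new variables. *)
Lemma sys_deg_power d n : sys_deg d.+1 ->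
  E i (fun v => g v ^+ n.+1 * \prod_(k <- iota 0 (n.+1 * d).+1) v k i).
Proof.
move=> Ed; elim: n => [|n IH].
  by rewrite mul1n; apply: (sys_eq Ed) => v; rewrite expr1.
set Q := (n.+1 * d).+1 in IH.
(* The first [Q] variables are taken, so variables 1 to [d] move to [Q], ..., [Q + d - 1]. *)
pose Y k v := if k == 0%N then g v ^+ n.+1 * \prod_(l <- iota 0 Q) v l i
              else v (Q + k.-1)%N i.
have EY k : E i (Y k) by rewrite /Y; case: eqP => // _; exact: sys_var.
apply: (sys_eq (sys_with Ed EY)) => v.
rewrite g_with mon_with -[iota 0 d.+1]/(0%N :: iota 1 d) big_cons {1}/Y eqxx.
have -> : (n.+2 * d).+1 = (Q + d)%N by rewrite mulSn addnC.
rewrite iotaD big_cat add0n [g v ^+ n.+2]exprS -!mulrA; do 3!congr (_ * _).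
rewrite -[in RHS](addn0 Q) -[1%N]addn0 !iotaDl !big_map.
by apply: eq_bigr => k _; rewrite /Y.
Qed.

(** The coefficient [g ^+ p i] is [g] again, and the degree [p i * d.+1 + 1] overshoots the target
    by [d] periods, which are removed by lowering. *)
Lemma sys_deg_raise d : sys_deg d.+2 -> sys_deg (d.+2 + (p i).-1).
Proof.
move=> /(@sys_deg_power _ (p i).-1); rewrite prednK ?prime_gt0 //.
move=> Ed; apply: (@sys_deg_lower_iter d).
apply: (sys_eq Ed) => v; rewrite Fp_exp_p; congr (_ * _).
suff -> : (p i * d.+1).+1 = ((d.+1 + (p i).-1).+1 + d * (p i).-1)%N by [].
by have := prime_gt0 (p_prime i); case: (p i) => //= r _; nia.
Qed.

Lemma sys_deg_mod d t : sys_deg (d.+2 + t * (p i).-1) <-> sys_deg d.+2.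
Proof.
split; first exact: sys_deg_lower_iter.
elim: t => [|t IH]; first by rewrite addn0.
by move=> /IH /sys_deg_raise; rewrite mulSn addnCA addnC.
Qed.

End Pure.

End Component.

End Systems.

(** * Comparison of two systems through their graded parts *)

Section GradedParts.

Import GRing.Theory.
Local Open Scope ring_scope.

Variables (m : nat) (p : 'I_m -> nat).
Hypothesis p_prime : forall i, prime (p i).
Implicit Types E : forall i, set (valuation p -> 'F_(p i)).

Lemma sys_deg_incl E E' (i : 'I_m) K (g : valuation p -> 'F_(p i)) :
  system E -> system E' -> depends_on K pred0 g ->
  (forall d, (d <= p i)%N -> sys_deg E g d -> sys_deg E' g d) ->
  forall d, sys_deg E g d -> sys_deg E' g d.
Proof.
move=> sE sE' dg gEE' d; have p2 := prime_gt1 (p_prime i).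
have [/gEE' //|pd] := leqP d (p i).
(* The representative of [d] modulo [p i - 1] is chosen between 2 and [p i], where periodicity
   holds. *)
rewrite (_ : d = ((d - 2) %% (p i).-1).+2 + (d - 2) %/ (p i).-1 * (p i).-1)%N.
  rewrite !(sys_deg_mod p_prime _ dg) //; apply: gEE'.
  by have := @ltn_pmod (d - 2) (p i).-1; lia.
by rewrite addnC !addnS -divn_eq; lia.
Qed.

(** Induction on [N], the number of variables whose [i]-th component [u] may still read; [w]
    collects the variables already split off, and those from [M] on are fresh. *)
Lemma sys_mon_incl E E' (i : 'I_m) K :
  system E -> system E' ->
  (forall g d, depends_on K pred0 g -> (d <= p i)%N ->
    sys_deg (i := i) E g d -> sys_deg E' g d) ->
  forall N M (u : valuation p -> 'F_(p i)) (w : seq nat),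
    depends_on K (ltn^~ N) u -> (N <= M)%N -> uniq w ->
    (forall k, k \in w -> (N <= k < M)%N) ->
    E i (fun v => u v * \prod_(k <- w) v k i) ->
    E' i (fun v => u v * \prod_(k <- w) v k i).
Proof.
move=> sE sE' base; elim=> [|N IH] M u w du NM uw wNM Eu.
  have du0 : depends_on K pred0 u by apply: depends_on_sub du.
  apply/(sys_deg_mon sE' du0 uw); move/(sys_deg_mon sE du0 uw): Eu.
  by apply: (sys_deg_incl sE sE' du0) => d; exact: base.
have wN k : k \in w -> (N < k)%N by move=> /wNM; lia.
have E'e (e : 'I_(p i)) : E' i (fun v =>
    expansion_coef N e u v * v N i ^+ e * \prod_(k <- w) v k i).
  have := sys_expansion p_prime sE du wN (ltn_ord e) Eu.
  have due := @depends_on_expansion_coef _ _ _ K N e _ du.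
  (* Power 0 leaves [w] as it is; a positive power is polarized first, since the induction
     hypothesis concerns multilinear monomials only. *)
  case: (e : nat) (ltn_ord e) due => [|d] dp due Ee.
    have E0 : E i (fun v => expansion_coef N 0 u v * \prod_(k <- w) v k i).
      by apply: (sys_eq Ee) => v; rewrite expr0 mulr1.
    suff E'0 : E' i (fun v => expansion_coef N 0 u v * \prod_(k <- w) v k i).
      by apply: (sys_eq E'0) => v; rewrite expr0 mulr1.
    by apply: (IH M) => // [|k /wNM]; lia.
  pose c v := expansion_coef N d.+1 u v * \prod_(k <- w) v k i.
  have dc : depends_on K [pred k | (k < M)%N && (k != N)] c.
    apply: depends_on_mul; first by apply: depends_on_sub due => k /=; lia.
    by apply: depends_on_sub (@depends_on_mon _ _ _ K w) => k /= /wNM; lia.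
  have Ec : E i (fun v => c v * v N i ^+ d.+1).
    by apply: (sys_eq Ee) => v; rewrite mulrAC.
  have {}Ec := sys_polarize p_prime sE dc NM dp Ec.
  pose w' := N :: w ++ iota M d.
  have E'c : E' i (fun v => expansion_coef N d.+1 u v * \prod_(k <- w') v k i).
    apply: (IH (M + d)%N) => //.
    - by lia.
    - rewrite /= mem_cat mem_iota cat_uniq uw iota_uniq andbT.
      apply/andP; split.
        by apply/negP => /orP[/wN|]; lia.
      by apply/hasPn => k; rewrite mem_iota => Mk; apply/negP => /wNM; lia.
    - move=> k; rewrite inE mem_cat mem_iota => /or3P[/eqP ->|/wNM|]; lia.
    - apply: (sys_eq Ec) => v; rewrite big_cons big_cat /= /c; ring.
  (* Identifying the fresh variables with [N] turns the polarized monomial back into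
     [y_N ^+ d.+1]. *)
  pose Y k (v : valuation p) := v (if (k < M)%N then k else N) i.
  have EY k : E' i (Y k) by exact: sys_var.
  apply: (sys_eq (sys_with sE' E'c EY)) => v.
  rewrite mon_with (depends_on_with due) => [|k /= kN]; last first.
    by rewrite /Y ifT //; lia.
  rewrite /w' big_cons big_cat /= {1}/Y NM.
  have -> : \prod_(k <- iota M d) Y k v = v N i ^+ d.
    rewrite big_seq (eq_bigr (fun=> v N i)) => [|k].
      by rewrite -big_seq big_const_seq count_predT size_iota iter_mulr_1.
    by rewrite mem_iota /Y => /andP[Mk _]; rewrite ltnNge Mk.
  have -> : \prod_(k <- w) Y k v = \prod_(k <- w) v k i.
    rewrite !big_seq; apply: eq_bigr => k /wNM kM.
    by rewrite /Y ifT //; lia.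
  by rewrite exprS; ring.
have := sys_sum sE' (index_enum 'I_(p i)) E'e.
move/sys_eq; apply => v.
by rewrite -mulr_suml -(expansion p_prime _ du).
Qed.

Definition other_comps (i : 'I_m) (n : nat) (v : valuation p) :
    prod_power (other_primes p i) n.+1 :=
  fun j => \col_(k < n.+1) v k (val j).

(** Matching on [idP] yields the proof of [j != i] that indexes [x]. Defaults: component [i] is 0,
    and [inord] sends every [k > n] to row 0. *)
Definition of_other_comps (i : 'I_m) (n : nat)
    (x : prod_power (other_primes p i) n.+1) : valuation p :=
  fun k j => match @idP (j != i) with
             | ReflectT ji => x (Sub j ji) (inord k) ord0
             | ReflectF _ => 0
             end.

Lemma other_compsK (i : 'I_m) n (v : valuation p) k j :
  (k < n.+1)%N -> i != j -> of_other_comps (other_comps (i := i) n v) k j = v k j.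
Proof.
move=> kn ij; rewrite /of_other_comps; case: {-}_ / idP => [ji|].
  by rewrite mxE inordK.
by rewrite eq_sym ij.
Qed.

(** The set [D_(i,d)], whose members are read on the first variables of a valuation. *)
Definition graded_part E (i : 'I_m) (d : nat) :
    set (multiary (prod_power (other_primes p i)) 'F_(p i)) :=
  [set f : multiary (prod_power (other_primes p i)) 'F_(p i) |
    sys_deg E (fun v => projT2 f (@other_comps i (projT1 f) v)) d].

Lemma graded_part_clonoid E (i : 'I_m) d :
  system E -> is_lin_clonoid (@graded_part E i d).
Proof.
move=> sE; split.
- exists (existT (fun n => prod_power (other_primes p i) n.+1 -> 'F_(p i))
    0%N (fun=> 0)).
  rewrite /graded_part /sys_deg /=; apply: (sys_eq (sys0 sE i)) => v.
  by rewrite mul0r.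
- move=> n f g a b Ef Eg; rewrite /of_arity /graded_part /sys_deg /=.
  apply: (sys_eq (sys_lin sE a b Ef Eg)) => v /=.
  by rewrite mulrDl !mulrA.
move=> l n f M Ef.
(* The matrices act by a substitution that fixes component [i], hence also the monomial. *)
pose G k j (v : valuation p) : 'F_(p j) :=
  match @idP (j != i) with
  | ReflectT ji => \sum_(t < l.+1) M (Sub j ji) (inord k) t * v t j
  | ReflectF _ => v k j
  end.
have EG k j : E j (G k j).
  rewrite /G; case: {-}_ / idP => [ji|_]; last exact: sys_var.
  by apply: sys_sum => // t; apply: sys_scale => //; exact: sys_var.
rewrite /of_arity /graded_part /sys_deg /=.
apply: (sys_eq (sys_subst sE Ef EG)) => v /=; congr (f _ * _).
  apply: functional_extensionality_dep => -[j ji]; apply/matrixP => k z.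
  rewrite !mxE /G /=; case: {-}_ / idP => [ji'|]; last by rewrite ji.
  rewrite (bool_irrelevance ji' ji) inord_val.
  by apply: eq_bigr => t _; rewrite !mxE.
apply: eq_bigr => k _; rewrite /G; case: {-}_ / idP => // ii.
by exfalso; move: (ii); rewrite eqxx.
Qed.

Lemma graded_part_incl E E' (i : 'I_m) : system E -> system E' ->
  (forall d, (d <= p i)%N -> @graded_part E i d = @graded_part E' i d) ->
  (E i `<=` E' i)%classic.
Proof.
move=> sE sE' EE' h Eh; have [n hn] := sys_fin sE Eh.
(* Arities start at 1, so [n.+1] variables are allowed even if [h] reads none. *)
have dh : depends_on n.+1 (ltn^~ n.+1) h.
  move=> v v' vn vi; apply: hn => k kn.
  apply: functional_extensionality_dep => j.
  by have [<-|ij] := eqVneq i j; [apply: vi | apply: vn] => //=; lia.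
have base g d : depends_on (i := i) n.+1 pred0 g -> (d <= p i)%N ->
    sys_deg E g d -> sys_deg E' g d.
  move=> dg dp.
  (* A coefficient free of [i]-th components is a function of arity [n.+1] of the other components,
     so the equality of graded parts applies to it. *)
  pose f : prod_power (other_primes p i) n.+1 -> 'F_(p i) :=
    fun x => g (of_other_comps x).
  have fE : g = fun v => f (@other_comps i n v).
    by apply/funext => v; apply: dg => // k j kn ij; rewrite other_compsK.
  have : @graded_part E i d (existT _ n f) -> @graded_part E' i d (existT _ n f).
    by rewrite EE'.
  by rewrite /graded_part /= -fE.
have Eh1 : E i (fun v => h v * \prod_(k <- [::]) v k i).
  by apply: (sys_eq Eh) => v; rewrite big_nil mulr1.
apply: (sys_eq (@sys_mon_incl _ _ _ _ sE sE' base _ n.+1 h [::] dh _ _ _ Eh1)) => // v.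
by rewrite big_nil mulr1.
Qed.

End GradedParts.

(** * The Chinese remainder theorem for [Z_s] *)

Section ChineseRemainder.

Import GRing.Theory.
Local Open Scope ring_scope.

Variables (m : nat) (p : 'I_m -> nat) (s : nat).
Hypotheses (m_gt0 : (0 < m)%N) (p_prime : forall i, prime (p i)).
Hypotheses (p_inj : injective p) (s_def : s = (\prod_(i < m) p i)%N).

Lemma p_dvd_s i : (p i %| s)%N.
Proof. by rewrite s_def (bigD1 i) //= dvdn_mulr. Qed.

Lemma s_gt1 : (1 < s)%N.
Proof.
apply: leq_trans (prime_gt1 (p_prime (Ordinal m_gt0))) (dvdn_leq _ (p_dvd_s _)).
by rewrite s_def prodn_gt0 // => i; exact: prime_gt0.
Qed.

Lemma s_dvdP n : (forall i, p i %| n)%N -> (s %| n)%N.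
Proof.
move=> pn; rewrite s_def -big_enum; have := enum_uniq 'I_m.
elim: (enum 'I_m) => [|i r IH]; first by rewrite big_nil.
rewrite big_cons => /= /andP[ir /IH {}IH]; rewrite Gauss_dvd ?pn //.
rewrite prime_coprime // Euclid_dvd_prod // big_has.
apply/hasPn => j jr; rewrite dvdn_prime2 // (inj_eq p_inj).
by apply: contra ir => /eqP ->.
Qed.

Definition residue (x : 'Z_s) (j : 'I_m) : 'F_(p j) := (x : nat)%:R.

Lemma residue_nat n j : residue n%:R j = n%:R.
Proof.
rewrite /residue (val_Zp_nat s_gt1) -(Fp_nat_mod (p_prime j)).
by rewrite (modn_dvdm _ (p_dvd_s j)) (Fp_nat_mod (p_prime j)).
Qed.

Lemma residueD x y j : residue (x + y) j = residue x j + residue y j.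
Proof.
by rewrite -[x]natr_Zp -[y]natr_Zp -natrD !residue_nat natrD.
Qed.

Lemma residueMn x n j : residue (x *+ n) j = residue x j *+ n.
Proof. by rewrite -[x]natr_Zp -mulrnA !residue_nat mulrnA. Qed.

Lemma residue_sum (I : Type) (r : seq I) (F : I -> 'Z_s) j :
  residue (\sum_(t <- r) F t) j = \sum_(t <- r) residue (F t) j.
Proof.
elim: r => [|t r IH]; first by rewrite !big_nil -[0]/(0%:R) residue_nat.
by rewrite !big_cons residueD IH.
Qed.

Lemma residue_inj x y : (forall j, residue x j = residue y j) -> x = y.
Proof.
wlog xy : x y / (x <= y)%N => [wl|] xyj.
  by case/orP: (leq_total x y) => /wl; [|move=> yx; symmetry]; auto.
apply/val_inj/eqP; rewrite eqn_leq xy /= -subn_eq0.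
have ys : (y < s)%N by rewrite -[X in (_ < X)%N](Zp_cast s_gt1).
have : (s %| y - x)%N.
  apply: s_dvdP => j; rewrite (dvdn_pcharf (pchar_Fp (p_prime j))) natrB //.
  by rewrite -/(residue y j) -/(residue x j) xyj subrr.
by move/dvdn_leq => le; apply: contraLR ys; rewrite -lt0n -leqNgt => /le; lia.
Qed.

Definition cofactor (i : 'I_m) : nat := (\prod_(j < m | j != i) p j)%N.

(** The Chinese remainder idempotent, kept as a natural number so that multiplying by it is repeated
    addition. *)
Definition idem (i : 'I_m) : nat :=
  (cofactor i * ((cofactor i)%:R^-1 : 'F_(p i)))%N.

Lemma idem_in i : (idem i)%:R = 1 :> 'F_(p i).
Proof.
rewrite /idem natrM natr_Zp mulfV // -(dvdn_pcharf (pchar_Fp (p_prime i))).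
rewrite /cofactor Euclid_dvd_prod // big_has_cond.
apply/hasPn => j _; rewrite /= dvdn_prime2 // (inj_eq p_inj).
by rewrite [i == j]eq_sym andNb.
Qed.

Lemma idem_out i j : i != j -> (idem i)%:R = 0 :> 'F_(p j).
Proof.
move=> ij; rewrite /idem /cofactor (bigD1 j) 1?eq_sym //= -mulnA natrM.
by rewrite pchar_Fp_0 // mul0r.
Qed.

Definition inject (i : 'I_m) (c : 'F_(p i)) : 'Z_s := (idem i * c)%:R.

Lemma residue_inject_in i (c : 'F_(p i)) : residue (inject c) i = c.
Proof. by rewrite residue_nat natrM idem_in mul1r natr_Zp. Qed.

Lemma residue_inject_out i j (c : 'F_(p i)) : i != j -> residue (inject c) j = 0.
Proof. by move=> ij; rewrite residue_nat natrM idem_out // mul0r. Qed.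

Definition combine (x : forall j, 'F_(p j)) : 'Z_s := \sum_j inject (x j).

Lemma residue_combine x : residue (combine x) = x.
Proof.
apply: functional_extensionality_dep => j.
rewrite residue_sum (bigD1 j) //= residue_inject_in big1 ?addr0 // => i ij.
exact: residue_inject_out.
Qed.

Lemma combine_residue x : combine (residue x) = x.
Proof. by apply: residue_inj => j; rewrite residue_combine. Qed.

(** The projection to the [i]-th summand is thus repeated addition, available in every clone
    containing the addition. *)
Lemma inject_residue x i : inject (residue x i) = x *+ idem i.
Proof.
apply: residue_inj => j; rewrite residueMn -mulr_natr.
have [<-|ij] := eqVneq i j; first by rewrite residue_inject_in idem_in mulr1.
by rewrite residue_inject_out // idem_out // mulr0.
Qed.

Lemma inject_lin i (a b c d : 'F_(p i)) :
  inject (a * c + b * d) = inject c *+ a + inject d *+ b.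
Proof.
apply: residue_inj => j; rewrite residueD (residueMn (inject c)) (residueMn (inject d)).
have [<-|ij] := eqVneq i j.
  by rewrite !residue_inject_in; congr (_ + _); rewrite -mulr_natl natr_Zp.
by rewrite !residue_inject_out // !mul0rn addr0.
Qed.

(** * Clones as sets of functions on infinite sequences, and the systems they define *)

Definition term_functions (C : set (operation 'Z_s)) :
    set ((nat -> 'Z_s) -> 'Z_s) :=
  [set F | exists n (f : power 'Z_s n.+1 -> 'Z_s),
    of_arity C f /\ F = fun v : nat -> 'Z_s => f (fun i => v i)].

Section Clone.

Variable C : set (operation 'Z_s).
Hypotheses (cloneC : is_clone C) (addC : (Clo_add 'Z_s `<=` C)%classic).

Lemma term_functions_var k : term_functions C (fun v => v k).
Proof. by exists k, (fun x => x ord_max); split=> //; exact: (proj1 cloneC). Qed.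

Lemma of_arity_widen n l (f : power 'Z_s n.+1 -> 'Z_s) (nl : (n < l.+1)%N) :
  of_arity C f ->
  of_arity C (fun x : power 'Z_s l.+1 => f (fun i => x (widen_ord nl i))).
Proof.
move=> Cf; apply: (proj2 cloneC) Cf _ => i; exact: (proj1 cloneC).
Qed.

Lemma term_functions_comp F (G : nat -> (nat -> 'Z_s) -> 'Z_s) :
  term_functions C F -> (forall k, term_functions C (G k)) ->
  term_functions C (fun v => F (fun k => G k v)).
Proof.
move=> [n [f [Cf ->]]] CG.
have {CG} /choice[a CG] : forall k, exists a : multiary (power 'Z_s) 'Z_s,
    of_arity C (projT2 a) /\ G k = fun v => projT2 a (fun i => v i).
  by move=> k; have [l [g Cg]] := CG k; exists (existT _ l g).
(* The functions substituted into [f] may differ in arity; all are widened to the largest one. *)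
pose L := (\max_(k < n.+1) projT1 (a k))%N.
have aL (k : 'I_n.+1) : (projT1 (a k) < L.+1)%N.
  by rewrite ltnS; exact: (leq_bigmax k).
exists L, (fun x => f (fun k => projT2 (a k) (fun i => x (widen_ord (aL k) i)))).
split.
  by apply: (proj2 cloneC) Cf _ => k; apply: of_arity_widen; exact: (CG k).1.
apply/funext => v; congr f; apply/funext => k; rewrite (CG k).2.
by congr (projT2 (a k)).
Qed.

Lemma term_functions_add F G : term_functions C F -> term_functions C G ->
  term_functions C (fun v => F v + G v).
Proof.
move=> CF CG.
have Cadd : term_functions C (fun v => v 0%N + v 1%N).
  exists 1%N, (fun x => x ord0 + x ord_max); split=> //.
  by apply: addC; apply: sub_gen_smallest.
pose H k := if k == 0%N then F else G.
have CH k : term_functions C (H k) by rewrite /H; case: ifP.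
exact: (term_functions_comp Cadd CH).
Qed.

Lemma term_functions_mulrn F n : term_functions C F ->
  term_functions C (fun v => F v *+ n).
Proof.
move=> CF; have pos k : term_functions C (fun v => F v *+ k.+1).
  elim: k => [//|k IH].
  by under eq_fun => v do rewrite mulrSr; exact: term_functions_add.
(* Addition yields positive multiples only; the zero multiple is obtained as the [s]-th. *)
case: n => [|n //]; have := pos s.-1; rewrite prednK ?(ltnW s_gt1) //.
congr (term_functions C _); apply/funext => v.
by rewrite -mulr_natr pchar_Zp ?s_gt1 // mulr0.
Qed.

Lemma term_functions_sum (I : Type) (r : seq I) F :
  (forall t, term_functions C (F t)) ->
  term_functions C (fun v => \sum_(t <- r) F t v).
Proof.
move=> CF; elim: r => [|t r IH].
  have := term_functions_mulrn 0 (term_functions_var 0).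
  by congr (term_functions C _); apply/funext => v; rewrite big_nil.
by under eq_fun => v do rewrite big_cons; exact: term_functions_add.
Qed.

(** A witness of another arity is brought to the arity of [f] by substituting projections. *)
Lemma of_arityE n (f : power 'Z_s n.+1 -> 'Z_s) :
  of_arity C f <-> term_functions C (fun v => f (fun i => v i)).
Proof.
split=> [Cf|[l [g [Cg /funeqP fg]]]]; first by exists n, f.
suff -> : f = fun x => g (fun i => x (inord i)).
  by apply: (proj2 cloneC) Cg _ => i; exact: (proj1 cloneC).
apply/funext => x; have := fg (fun k => x (inord k)) => /= <-.
by congr f; apply/funext => i; rewrite inord_val.
Qed.

End Clone.

Definition clone_system C (i : 'I_m) : set (valuation p -> 'F_(p i)) :=
  [set h | term_functions C (fun v => inject (h (fun k => residue (v k))))].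

Arguments clone_system C i _ : clear implicits.

Lemma clone_systemP C : is_clone C -> (Clo_add 'Z_s `<=` C)%classic ->
  system (clone_system C).
Proof.
move=> cC addC; split.
- move=> i k; rewrite /clone_system /=.
  under eq_fun => v do rewrite inject_residue.
  by apply: term_functions_mulrn => //; exact: term_functions_var.
- move=> i h G Ch CG; rewrite /clone_system /=.
  (* The components [G k j] are glued into one function with values in [Z_s], which can be
     substituted for the [k]-th variable. *)
  pose G' k v := combine (fun j => G k j (fun l => residue (v l))).
  have CG' k : term_functions C (G' k).
    by apply: term_functions_sum => // j; exact: CG.
  have := term_functions_comp cC Ch CG'; congr (term_functions C _).
  apply/funext => v; congr (inject (h _)); apply/funext => k.
  by rewrite residue_combine.
- move=> i a b h h' Ch Ch'; rewrite /clone_system /=.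
  under eq_fun => v do rewrite inject_lin.
  by apply: term_functions_add => //; apply: term_functions_mulrn.
- move=> i h [n [f [_ /funeqP fh]]]; exists n.+1 => v v' vv'.
  (* [h] is recovered from the operation [f] representing it, so it reads only the [n.+1] arguments
     of [f]. *)
  have hE u : h u = residue (f (fun i => combine (u i))) i.
    rewrite -[LHS]residue_inject_in -(fh (fun k => combine (u k))) /=; congr (residue (inject (h _)) i).
    by apply/funext => k; rewrite residue_combine.
  rewrite !hE; congr (residue (f _) i); apply/funext => k.
  by rewrite vv'.
Qed.

(** An operation is the sum of its projections to the summands of [Z_s], and each projection comes
    from a member of [clone_system C i]. *)
Lemma clone_system_incl C C' :
  is_clone C -> (Clo_add 'Z_s `<=` C)%classic ->
  is_clone C' -> (Clo_add 'Z_s `<=` C')%classic ->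
  (forall i, clone_system C i `<=` clone_system C' i)%classic ->
  (C `<=` C')%classic.
Proof.
move=> cC addC cC' addC' CC' [n f] Cf.
have {}Cf : of_arity C f by [].
suff : of_arity C' f by [].
apply/(of_arityE cC'); move/(of_arityE cC): Cf.
set F := fun v : nat -> 'Z_s => _ => CF.
have CF' i : term_functions C' (fun v => inject (residue (F v) i)).
  have : clone_system C i (fun u => residue (F (fun k => combine (u k))) i).
    rewrite /clone_system /=; under eq_fun => v do rewrite inject_residue.
    apply: term_functions_mulrn => //.
    have := CF; congr (term_functions C _); apply/funext => v; congr F.
    by apply/funext => k; rewrite combine_residue.
  move/CC'; rewrite /clone_system /=; congr (term_functions C' _).
  apply/funext => v; congr (inject (residue (F _) i)).
  by apply/funext => k; rewrite combine_residue.
have := term_functions_sum cC' addC' (index_enum 'I_m) CF'.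
congr (term_functions C' _); apply/funext => v.
exact: combine_residue.
Qed.

End ChineseRemainder.

(** * The injection into the product of clonoid lattices *)

Theorem theorem1p2 (m : nat) (p : 'I_m -> nat) (s : nat)
    (m_gt0 : 0 < m)
    (p_prime : forall i : 'I_m, prime (p i))
    (p_distinct : injective p)
    (s_def : s = \prod_(i < m) p i) :
  exists rho : set_type (clones_over_add s) ->
      forall i : 'I_m, 'I_(p i + 1) ->
        set_type (lin_clonoids (p i) (other_primes p i)),
    injective rho.
Proof.
have sysP (C : set_type (clones_over_add s)) :
    system (clone_system (p := p) (sval C)).
  have [cC addC] := set_mem (svalP C).
  exact: (clone_systemP m_gt0 p_prime p_distinct s_def).
(* The index [d] runs through the [p i + 1] degrees 0, ..., [p i]. *)
exists (fun C i d => SigSub (mem_set (@graded_part_clonoid _ _ _ i d (sysP C)))).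
(* The hypothesis is symmetric in [C] and [C'], so two inclusions give equality. *)
have incl (C C' : set_type (clones_over_add s)) : (forall i (d : 'I_(p i + 1)),
    graded_part (clone_system (sval C)) d =
    @graded_part _ p (clone_system (sval C')) i d) ->
    (sval C `<=` sval C')%classic.
  move=> CC'.
  have [cC addC] := set_mem (svalP C); have [cC' addC'] := set_mem (svalP C').
  apply: (clone_system_incl m_gt0 p_prime p_distinct s_def) => // i.
  apply: (graded_part_incl p_prime (sysP C) (sysP C')) => d.
  by rewrite -ltnS -[(p i).+1]addn1 => dp; exact: (CC' i (Ordinal dp)).
move=> C C' CC'.
have eqD i (d : 'I_(p i + 1)) :
    graded_part (clone_system (sval C)) d =
    @graded_part _ p (clone_system (sval C')) i d.
  have := congr1 (fun r => sval (r i d)) CC'.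
  by [].
by apply: val_inj; apply/seteqP; split; apply: incl => i d.
Qed.
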